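(* If both $u$ and $w$ are concave, and there exists $\lambda^*\geq0$ such that $(u')_l^{-1}\big(\frac{\lambda^*}{w'(1-x)}\big)>0$ for all $x\in(0,1)$ and $$\int_0^1 (u')_l^{-1}\Big(\frac{\lambda^*}{w'(1-x)}\Big)\,\mathrm{d}x=s,$$ then $G^*(x):=(u')_l^{-1}\big(\frac{\lambda^*}{w'(1-x)}\big)$, $x\in(0,1)$, $G^*(0):=0$, is an optimal solution to the problem of maximizing $J_Q(G):=\int_0^1u(G(x))\,w'(1-x)\,\mathrm{d}x$ over $G\in\mathcal{Q}$; that is, $G^*\in\mathcal{Q}$ and $J_Q(G)\le J_Q(G^* )$ for all $G\in\mathcal{Q}$.
   Context: Let $s>0$. $u:[0,\infty)\to[0,\infty)$ is nondecreasing and absolutely continuous (on every compact interval) with $u(0)=0$; $w:[0,1]\to[0,1]$ is strictly increasing and absolutely continuous with $w(0)=0$, $w(1)=1$. $\mathcal{Q}$ is the set of quantile functions $G:[0,1)\to[0,\infty)$ (i.e. $G(0)=0$, $G(x)>0$ for all $x\in(0,1)$, $G$ nondecreasing and left-continuous) with $\int_0^1G(x)\,\mathrm{d}x\leq s$. Notation: $u'(x):=\limsup_{h\to0+}\frac{u(x+h)-u(x)}{h}$ and $(u')_l^{-1}(x):=\inf\{y\geq0: u'(y)\leq x\}$ (with $\inf\emptyset=+\infty$); $w'$ denotes likewise the right derivative of $w$. *)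

(* Defs.v *)
From HB Require Import structures.
From mathcomp Require Import all_boot all_order all_algebra.
From mathcomp Require Import all_classical all_reals all_analysis.
Import Order.TTheory GRing.Theory Num.Theory.
Import numFieldNormedType.Exports.

Set Implicit Arguments.
Unset Strict Implicit.
Unset Printing Implicit Defensive.

Local Open Scope classical_set_scope.
Local Open Scope ring_scope.

(* Functions on [0, +oo[, [0, 1] and [0, 1[ are represented by total functions
   R -> R; their values outside the intended domain are unconstrained and are
   never used. *)

Definition absolutely_continuous (R : realType) (a b : R) (f : R -> R) : Prop :=
  forall e : R, 0 < e -> exists2 d : R, 0 < d &
    forall (n : nat) (p q : 'I_n -> R),
      (forall i, [/\ a <= p i, p i < q i & q i <= b]) ->
      trivIset setT (fun i => `]p i, q i[%classic) ->
      \sum_(i < n) (q i - p i) < d ->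
      \sum_(i < n) `|f (q i) - f (p i)| < e.

Definition concave_function (R : realType) (D : set R) (f : R -> R) : Prop :=
  convex_function (D : set R^o) (\- f).

Definition right_deriv (R : realType) (f : R -> R) (x : R) : \bar R :=
  limf_esup (fun h : R => ((f (x + h) - f x) / h)%:E) 0^'+.

(* (u')_l^{-1}; ereal_inf set0 = +oo. *)
Definition right_deriv_linv (R : realType) (u : R -> R) (x : \bar R) : \bar R :=
  ereal_inf [set y%:E | y in [set y : R | 0 <= y /\ (right_deriv u y <= x)%E]].

Definition quantile_function (R : realType) (G : R -> R) : Prop :=
  [/\ G 0 = 0,
      (forall x, 0 < x < 1 -> 0 < G x),
      {in `[0, 1[ &, {homo G : x y / x <= y}} &
      (forall x, 0 < x < 1 -> G t @[t --> x^'-] --> G x)].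

(* Integrals over [0, 1] are taken over ]0, 1[: the endpoints are negligible,
   and the integrands (G at 1, right derivative of w at 1) may be meaningless
   there. *)
Definition admissible (R : realType) (s : R) : set (R -> R) :=
  [set G | quantile_function G /\
    (\int[lebesgue_measure]_(x in `]0%R, 1%R[) (G x)%:E <= s%:E)%E].

(* Extended-real valued: for admissible G the integrand is nonnegative, but
   the integral may be +oo. *)
Definition J_Q (R : realType) (u w : R -> R) (G : R -> R) : \bar R :=
  (\int[lebesgue_measure]_(x in `]0%R, 1%R[)
     ((u (G x))%:E * right_deriv w (1 - x)%R))%E.

Definition candidate (R : realType) (u w : R -> R) (lam x : R) : \bar R :=
  right_deriv_linv u (lam%:E / right_deriv w (1 - x)%R)%E.

(* The candidate is a priori extended-real valued; [fine] is faithful only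
   where it is finite. *)
Definition G_star (R : realType) (u w : R -> R) (lam x : R) : R :=
  if x == 0 then 0 else fine (candidate u w lam x).

(* Main.v *)
(* Let y = G_star x and c = lam / w'(1 - x). Since y is the least point where
   the right derivative of u is at most c, and y > 0, the number c is a
   supergradient of u at y. Hence, for every admissible H,
     u (H x) w'(1 - x) + lam (G_star x) <= u (G_star x) w'(1 - x) + lam (H x),
   and integrating over ]0, 1[ gives optimality, because G_star uses the whole
   budget s while H uses at most s. All integrands are monotone, which settles
   measurability. Left continuity of G_star comes from the right continuity of
   u' and w'. *)
Require Import Defs.
From HB Require Import structures.
From mathcomp Require Import all_boot all_order all_algebra.
From mathcomp Require Import all_classical all_reals all_analysis.
From mathcomp Require Import measurable_realfun ring lra.
Import Order.TTheory GRing.Theory Num.Theory.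
Import numFieldNormedType.Exports.
Local Open Scope classical_set_scope.
Local Open Scope ring_scope.

(** * Chords, right continuity and measurability *)

Lemma concave_chord {R : realType} {D : set R} {f : R -> R} {x y z : R} :
  concave_function D f -> D x -> D z -> x < y -> y < z ->
  (z - y) * f x + (y - x) * f z <= (z - x) * f y.
Proof.
move=> cf Dx Dz xy yz.
have zx0 : 0 < z - x by lra.
(* This weight on [x] makes the convex combination of [x] and [z] equal to [y]; scaling by [z - x]
   then clears denominators. *)
have t0 : 0 <= (z - y) / (z - x) by rewrite divr_ge0//; lra.
have t1 : (z - y) / (z - x) <= 1 by rewrite ler_pdivrMr//; lra.
have := cf (Itv01 t0 t1) x z (mem_set Dx) (mem_set Dz).
rewrite convRE /= /unstable.onem [X in - f X <= _](_ : _ = y); last first.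
  apply: etrans (convRE x z _) _; rewrite /= /unstable.onem.
  by field; rewrite gt_eqF.
rewrite -(ler_pM2l zx0) [leRHS](_ : _ = - ((z - y) * f x + (y - x) * f z)).
  by rewrite mulrN lerN2.
by field; rewrite gt_eqF.
Qed.

(** Absolute continuity is applied to the one-interval family []x, t[]. *)
Lemma ac_right_continuous {R : realType} {a b x : R} {f : R -> R} :
  Defs.absolutely_continuous a b f -> a <= x -> x < b ->
  f t @[t --> x^'+] --> f x.
Proof.
move=> acf ax xb; apply/cvgrPdist_lt => e e0.
have [d d0 H] := acf e e0.
near=> t.
have xt : x < t by near: t; exact: nbhs_right_gt.
have := H 1%N (fun=> x) (fun=> t).
rewrite !big_ord1 distrC; apply.
- by move=> _; split => //; near: t; exact: nbhs_right_le.
- by move=> i j _ _ _; rewrite !ord1.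
- rewrite ltrBlDl; near: t; apply: nbhs_right_lt; lra.
Unshelve. all: by end_near. Qed.

(** Superlevel sets of a monotone function on an interval are again intervals. *)
Lemma nondecreasing_in_measurable {R : realType} {D : set R} {f : R -> \bar R} :
  is_interval D -> {in D &, {homo f : x y / x <= y >-> (x <= y)%E}} ->
  measurable_fun D f.
Proof.
move=> iD fD; apply: (measurability _ (ErealGenOInfty.measurableE R)).
move=> /= _ [_ [a ->]] <-; apply: is_interval_measurable => s t /=.
rewrite !in_itv/= !andbT => -[Ds fs] [Dt ft] v /andP[sv vt].
have Dv : D v by apply: (iD s t) => //; apply/andP.
split => //; rewrite in_itv/= andbT (lt_le_trans fs)//.
by apply: fD; rewrite ?inE.
Qed.

(** * Right derivatives of concave functions *)

Section concave_right_deriv.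
Context {R : realType} {D : set R} {f : R -> R}.
Hypotheses (iD : is_interval D) (cf : concave_function D f).

(** By concavity every quotient with step [h < y - x] dominates the chord slope, and each right
    neighbourhood of 0 contains such an [h]. *)
Lemma right_deriv_ge_slope {x y : R} : D x -> D y -> x < y ->
  (((f y - f x) / (y - x))%:E <= right_deriv f x)%E.
Proof.
move=> Dx Dy xy; apply/ereal_infP => _ [V V0 <-].
have yx0 : 0 < y - x by lra.
have [h [h0 hy Vh]] : exists h : R, [/\ 0 < h, h < y - x & V h].
  near (0 : R)^'+ => h; exists h; split; near: h => //.
  - exact: nbhs_right_gt.
  - exact: nbhs_right_lt.
apply: le_ereal_sup_tmp; exists ((f (x + h) - f x) / h)%:E; first by exists h.
rewrite lee_fin ler_pdivrMr// mulrAC ler_pdivlMr//.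
have := concave_chord cf Dx Dy (_ : x < x + h) (_ : x + h < y).
rewrite ltrDl -ltrBrDl addrAC subrr add0r => /(_ h0 hy); lra.
Unshelve. all: by end_near. Qed.

(** Trades the limsup for affine inequalities, which survive passage to the limit. The point [b]
    certifies that the domain extends to the right of [x]. *)
Lemma right_deriv_leP {c x b : R} : D x -> D b -> x < b ->
  (right_deriv f x <= c%:E)%E <->
  (forall y, D y -> x < y -> f y - f x <= c * (y - x)).
Proof.
move=> Dx Db xb; split=> [xc y Dy xy|H].
  have := le_trans (right_deriv_ge_slope Dx Dy xy) xc.
  by rewrite lee_fin ler_pdivrMr// subr_gt0.
(* One right neighbourhood of 0 suffices; [h < b - x] keeps [x + h] in [D]. *)
apply: ge_ereal_inf.
exists (ereal_sup
  ((fun h => ((f (x + h) - f x) / h)%:E) @` [set h | 0 < h < b - x])).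
  exists [set h | 0 < h < b - x] => //.
  near=> h; apply/andP; split; near: h; first exact: nbhs_right_gt.
  by apply: nbhs_right_lt; lra.
apply/ereal_supP => _ [h /= /andP[h0 hb] <-].
rewrite lee_fin ler_pdivrMr//.
have := H (x + h); rewrite addrAC subrr add0r; apply; last lra.
by apply: (iD x b) => //; lra.
Unshelve. all: by end_near. Qed.

Lemma right_deriv_le_slope {a x b : R} : D a -> D x -> D b -> a < x -> x < b ->
  (right_deriv f x <= ((f x - f a) / (x - a))%:E)%E.
Proof.
move=> Da Dx Db ax xb; apply/(right_deriv_leP Dx Db xb) => y Dy xy.
rewrite mulrAC ler_pdivlMr ?subr_gt0//.
by have := concave_chord cf Da Dy ax xy; nra.
Qed.

Lemma right_deriv_nonincreasing {x y b : R} : D x -> D y -> D b ->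
  x <= y -> y < b -> (right_deriv f y <= right_deriv f x)%E.
Proof.
move=> Dx Dy Db; rewrite le_eqVlt => /orP[/eqP->//|xy yb].
exact: le_trans (right_deriv_le_slope Dx Dy Db xy yb)
                (right_deriv_ge_slope Dx Dy xy).
Qed.

(** For fixed [y], the inequality [f y - f t <= c * (y - t)] passes to the limit as [t] decreases to
    [x]. Together with monotonicity this is right continuity of the right derivative. *)
Lemma right_deriv_le_right_limit {c x b : R} : D x -> D b -> x < b ->
  f t @[t --> x^'+] --> f x ->
  (forall t, x < t -> t < b -> (right_deriv f t <= c%:E)%E) ->
  (right_deriv f x <= c%:E)%E.
Proof.
move=> Dx Db xb fx H; apply/(right_deriv_leP Dx Db xb) => y Dy xy.
have Hl : f y - f t - c * (y - t) @[t --> x^'+] --> f y - f x - c * (y - x).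
  apply: cvgB; first by apply: cvgB => //; exact: cvg_cst.
  apply: cvgM; first exact: cvg_cst.
  apply: cvgB; [exact: cvg_cst|apply: cvg_within_filter; exact: cvg_id].
rewrite -subr_le0 -(cvg_lim _ Hl)//.
apply: limr_le; first by apply/cvg_ex; eexists; exact: Hl.
near=> t.
have xt : x < t by near: t; exact: nbhs_right_gt.
have ty : t < y by near: t; exact: nbhs_right_lt.
have tb : t < b by near: t; exact: nbhs_right_lt.
have Dt : D t by apply: (iD x b) => //; lra.
have /(right_deriv_leP Dt Db tb)/(_ y Dy ty) := H t xt tb; lra.
Unshelve. all: by end_near. Qed.

End concave_right_deriv.

(** * The left inverse of u' and supergradients of u *)

Lemma right_deriv_linv_antitone {R : realType} (u : R -> R) (x y : \bar R) :
  (x <= y)%E -> (right_deriv_linv u y <= right_deriv_linv u x)%E.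
Proof.
move=> xy; apply: ereal_inf_le_tmp; apply: image_subset => z [z0 zx].
by split => //; exact: le_trans zx xy.
Qed.

Lemma right_deriv_linv_ge0 {R : realType} (u : R -> R) (x : \bar R) :
  (0 <= right_deriv_linv u x)%E.
Proof. by apply/ereal_infP => _ [y [y0 _] <-]; rewrite lee_fin. Qed.

Section concave_utility.
Context {R : realType} {u : R -> R}.
Hypotheses (cu : concave_function `[0, +oo[ u)
  (ru : forall x, 0 <= x -> u t @[t --> x^'+] --> u x).

Let nneg (x : R) : 0 <= x -> `[0, +oo[%classic x.
Proof. by rewrite /= in_itv/= andbT. Qed.

Let inneg : is_interval (`[0, +oo[%classic : set R).
Proof. exact: interval_is_interval. Qed.

(* The infimum defining [right_deriv_linv] is attained because the right
   derivative of a concave function is right-continuous. *)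
Lemma right_deriv_linv_leP {c y : R} : 0 <= y ->
  (right_deriv_linv u c%:E <= y%:E)%E <-> (right_deriv u y <= c%:E)%E.
Proof.
move=> y0; split=> [cy|uy]; last first.
  by apply: ge_ereal_inf; exists y%:E => //; exists y.
apply: (right_deriv_le_right_limit inneg cu (b := y + 1)) => //.
- exact: nneg.
- by apply: nneg; lra.
- by lra.
- exact: ru.
move=> t yt ty1.
have /ereal_inf_lt[_ [v [v0 vc] <-]] : (right_deriv_linv u c%:E < t%:E)%E.
  by apply: le_lt_trans cy _; rewrite lte_fin.
rewrite lte_fin => vt; apply: le_trans vc.
by apply: (right_deriv_nonincreasing inneg cu (b := y + 1)) => //;
  try apply: nneg; lra.
Qed.

(** Right of [y], attainment of the infimum bounds slopes above by [c]; left of [y], minimality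
    bounds them below by [c]. *)
Lemma right_deriv_linv_supergradient {c y z : R} :
  {in `[0, +oo[ &, {homo u : a b / a <= b}} ->
  right_deriv_linv u c%:E = y%:E -> 0 < y -> 0 <= z ->
  u z - u y <= c * (z - y).
Proof.
move=> u_nd cy y0 z0; case: (ltgtP y z) => [yz|zy|<-]; last by rewrite !subrr mulr0.
  have : (right_deriv u y <= c%:E)%E.
    by apply/right_deriv_linv_leP; [lra|rewrite cy].
  by move/(right_deriv_leP inneg cu (nneg _ (ltW y0)) (nneg _ z0) yz); apply => //;
    exact: nneg.
(* Minimality of [y] gives u'(t) > c, so the chord from [z] to [t] has slope above [c]. Replacing
   [u t] by [u y] through monotonicity leaves only an affine term in the limit [t] to [y]. *)
have below t : z < t -> t < y -> c * (t - z) <= u y - u z.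
  move=> zt ty; have t0 : 0 <= t by lra.
  have : ~~ (right_deriv u t <= c%:E)%E.
    apply/negP => /(right_deriv_linv_leP t0).2; rewrite cy lee_fin; lra.
  rewrite -ltNge => ct.
  have := lt_le_trans ct (right_deriv_le_slope inneg cu
    (nneg _ z0) (nneg _ t0) (nneg _ (ltW y0)) zt ty).
  rewrite lte_fin ltr_pdivlMr ?subr_gt0// => /ltW/le_trans; apply.
  by rewrite lerD2r; apply: u_nd; rewrite ?in_itv/= ?andbT; lra.
have Hl : c * (t - z) @[t --> y^'-] --> c * (y - z).
  apply: cvgM; first exact: cvg_cst.
  by apply: cvgB; [apply: cvg_within_filter; exact: cvg_id|exact: cvg_cst].
have : c * (y - z) <= u y - u z.
  rewrite -(cvg_lim _ Hl)//; apply: limr_le; first by apply/cvg_ex; eexists; exact: Hl.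
  near=> t; apply: below; near: t; last exact: nbhs_left_lt.
  exact: nbhs_left_gt.
by lra.
Unshelve. all: by end_near. Qed.

End concave_utility.

(** * The weight [p], that is w' at 1 - x *)

Section optimal_quantile.
Context {R : realType} {u w : R -> R} {lam s : R}.
Hypotheses (cu : concave_function `[0, +oo[ u)
  (u_nd : {in `[0, +oo[ &, {homo u : x y / x <= y}})
  (u0 : u 0 = 0)
  (ru : forall x, 0 <= x -> u t @[t --> x^'+] --> u x)
  (cw : concave_function `[0, 1] w)
  (w_inc : {in `[0, 1] &, {homo w : x y / x < y}})
  (rw : forall x, 0 <= x -> x < 1 -> w t @[t --> x^'+] --> w x)
  (lam_ge0 : 0 <= lam)
  (candidate_gt0 : forall x, 0 < x < 1 -> (0 < candidate u w lam x)%E)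
  (candidate_int : (\int[lebesgue_measure]_(x in `]0%R, 1%R[)
     candidate u w lam x = s%:E)%E).

Let iw : is_interval (`[0, 1]%classic : set R).
Proof. exact: interval_is_interval. Qed.

Let in01 (x : R) : 0 <= x <= 1 -> `[0, 1]%classic x.
Proof. by rewrite /= in_itv. Qed.

Let iu : is_interval (`[0, +oo[%classic : set R).
Proof. exact: interval_is_interval. Qed.

Let nneg (x : R) : 0 <= x -> `[0, +oo[%classic x.
Proof. by rewrite /= in_itv/= andbT. Qed.

Let p (x : R) := fine (right_deriv w (1 - x)).

(** Concavity squeezes w'(1 - x) between the slopes of the chords over [[1 - x, 1]] and
    [[0, 1 - x]]; the former is positive as [w] increases strictly. *)
Let pE (x : R) : 0 < x < 1 -> right_deriv w (1 - x) = (p x)%:E /\ 0 < p x.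
Proof.
move=> /andP[x0 x1].
have D0 := in01 0 ltac:(lra).
have Dx := in01 (1 - x) ltac:(lra).
have D1 := in01 1 ltac:(lra).
have ge := right_deriv_ge_slope cw Dx D1 ltac:(lra).
have le := right_deriv_le_slope iw cw D0 Dx D1 ltac:(lra) ltac:(lra).
have gt0 : 0 < (w 1 - w (1 - x)) / (1 - (1 - x)).
  rewrite divr_gt0//; last lra.
  by rewrite subr_gt0; apply: w_inc; rewrite ?in_itv/=; lra.
rewrite /p; case: (right_deriv w (1 - x)) ge le => //= r.
by rewrite !lee_fin => /(lt_le_trans gt0).
Qed.

Let p_nd (x y : R) : 0 < x -> x <= y -> y < 1 -> p x <= p y.
Proof.
move=> x0 xy y1; have [px _] := pE x ltac:(lra); have [py _] := pE y ltac:(lra).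
rewrite -lee_fin -px -py.
by apply: (right_deriv_nonincreasing iw cw (b := 1)); try apply: in01; lra.
Qed.

(** The reflection of [x] to [1 - x] turns right continuity of w' into left continuity of [p]. *)
Let p_left_limit (x c : R) : 0 < x < 1 ->
  (forall t, 0 < t -> t < x -> p t <= c) -> p x <= c.
Proof.
move=> x01 H; rewrite -lee_fin -(pE x x01).1.
apply: (right_deriv_le_right_limit iw cw (b := 1)); try apply: in01; try lra.
- by apply: rw; lra.
move=> t xt t1; have := pE (1 - t) ltac:(lra).
have -> : 1 - (1 - t) = t by lra.
by case=> -> _; rewrite lee_fin; apply: H; lra.
Qed.

(** * Monotonicity, finiteness and left continuity of the candidate *)

Let candE (x : R) : 0 < x < 1 ->
  candidate u w lam x = right_deriv_linv u (lam / p x)%:E.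
Proof.
move=> x01; rewrite /candidate; have [-> px0] := pE x x01.
by rewrite inver gt_eqF.
Qed.

Let cand_nd : {in `]0, 1[%classic &,
  {homo candidate u w lam : x y / x <= y >-> (x <= y)%E}}.
Proof.
move=> x y; rewrite !inE /= !in_itv/= => x01 y01 xy.
rewrite !candE//; apply: right_deriv_linv_antitone.
have [_ px0] := pE x x01; have [_ py0] := pE y y01.
rewrite lee_fin ler_wpM2l// lef_pV2//; apply: p_nd => //; lra.
Qed.

Let cand_measurable : measurable_fun `](0 : R), 1[ (candidate u w lam).
Proof.
by apply: nondecreasing_in_measurable cand_nd; exact: interval_is_interval.
Qed.

Let cand_ge0 (x : R) : (0 <= candidate u w lam x)%E.
Proof. exact: right_deriv_linv_ge0. Qed.

(** An infinite value at [x] would persist on [[x, 1[] by monotonicity; this interval has positive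
    length, so the integral could not be the finite [s]. *)
Lemma candidate_fin_num (x : R) : 0 < x < 1 -> candidate u w lam x \is a fin_num.
Proof.
move=> x01; rewrite ge0_fin_numE// ltey; apply/eqP => xy.
have : (\int[lebesgue_measure]_(x in `[x, 1%R[) (cst +oo x)
    <= \int[lebesgue_measure]_(x in `]0%R, 1%R[) candidate u w lam x :> \bar R)%E.
  apply: (@le_trans _ _ (\int[lebesgue_measure]_(x in `[x, 1%R[) candidate u w lam x)%E).
    rewrite le_eqVlt; apply/orP; left; apply/eqP/eq_integral => y.
    rewrite inE /= in_itv/= => /andP[xley y1].
    apply/esym/eqP; rewrite -leye_eq -xy; apply: cand_nd => //;
    rewrite inE /= in_itv/=; lra.
  apply: ge0_subset_integral => //.
  by apply: subset_itvr; rewrite bnd_simp; lra.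
rewrite integral_cst//= lebesgue_measure_itv/= lte_fin ifT; last lra.
rewrite candidate_int gt0_mulye// lte_fin; lra.
Qed.

Let G := G_star u w lam.

Let GE (x : R) : 0 < x < 1 -> candidate u w lam x = (G x)%:E.
Proof.
move=> x01; rewrite /G /G_star gt_eqF ?fineK//; last lra.
exact: candidate_fin_num.
Qed.

Let G_gt0 (x : R) : 0 < x < 1 -> 0 < G x.
Proof. by move=> x01; rewrite -lte_fin -GE//; exact: candidate_gt0. Qed.

Let G_nd : {in `[0, 1[ &, {homo G : x y / x <= y}}.
Proof.
move=> x y; rewrite !in_itv/= => /andP[x0 x1] /andP[y0 y1] xy.
have [->|x_neq0] := eqVneq x 0.
  rewrite {1}/G /G_star eqxx; have [->|y_neq0] := eqVneq y 0.
    by rewrite /G /G_star eqxx.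
  by apply: ltW; apply: G_gt0; lra.
have x_gt0 : 0 < x by rewrite lt_def x_neq0.
rewrite -lee_fin -!GE; [|lra..].
by apply: cand_nd => //; rewrite inE /= in_itv/=; lra.
Qed.

(** By monotonicity only a jump has to be excluded: if [G] stays below [y = G x - e] on []0, x[],
    then u'(y) is at most [lam / p t] for all these [t]. Letting [t] tend to [x] gives [G x <= y], a
    contradiction. *)
Let G_left_continuous (x : R) : 0 < x < 1 -> G t @[t --> x^'-] --> G x.
Proof.
move=> x01; apply/cvgrPdist_lt => e e0.
have [[t [t0 tx Gt]]|noT] :=
    pselect (exists t, [/\ 0 < t, t < x & G x - e < G t]).
  near=> v.
  have vx : v < x by near: v; exact: nbhs_left_lt.
  have tv : t < v by near: v; exact: nbhs_left_gt.
  have Gtv : G t <= G v by apply: G_nd; rewrite ?in_itv/=; lra.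
  have Gvx : G v <= G x by apply: G_nd; rewrite ?in_itv/=; lra.
  rewrite ger0_norm; lra.
have Gle t : 0 < t -> t < x -> G t <= G x - e.
  by move=> t0 tx; rewrite leNgt; apply/negP => Gt; apply: noT; exists t.
have y0 : 0 <= G x - e.
  by apply: le_trans (Gle (x / 2) _ _); [apply/ltW/G_gt0|..]; lra.
set y := G x - e in Gle y0.
have y1 : y < y + 1 by lra.
have leP (c : R) := right_deriv_leP iu cu (c := c) (nneg _ y0)
  (nneg (y + 1) ltac:(lra)) y1.
have [_ px0] := pE x x01.
suff : G x <= y by rewrite /y; lra.
rewrite -lee_fin -GE// candE//.
apply/(right_deriv_linv_leP cu ru y0)/leP => z z_ge0 yz.
have zy0 : 0 < z - y by lra.
rewrite mulrAC ler_pdivlMr//.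
(* If [u z > u y], the slope inequality is an upper bound on [p x], to which [p_left_limit] applies;
   otherwise it holds by signs. *)
have [uzy|uzy] := lerP (u z - u y) 0.
  by apply: (@le_trans _ _ 0); [exact: mulr_le0_ge0 (ltW px0)|exact: mulr_ge0 (ltW zy0)].
rewrite mulrC -ler_pdivlMr//; apply: p_left_limit => // t t0 tx.
have t01 : 0 < t < 1 by lra.
have [_ pt0] := pE t t01.
have := Gle t t0 tx; rewrite -lee_fin -GE// candE//.
move/(right_deriv_linv_leP cu ru y0)/leP/(_ z z_ge0 yz).
by rewrite mulrAC !ler_pdivlMr// mulrC.
Unshelve. all: by end_near. Qed.

(** * Admissibility and optimality *)

Lemma G_star_admissible : admissible s G.
Proof.
split; last first.
  rewrite -candidate_int le_eqVlt; apply/orP; left; apply/eqP/eq_integral => x.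
  by rewrite inE /= in_itv/= => x01; rewrite GE.
by split => //; [rewrite /G /G_star eqxx].
Qed.

(* Weighting the supergradient inequality by [p x] clears the denominator. *)
Let pointwise_optimal (x y : R) : 0 < x < 1 -> 0 <= y ->
  u y * p x + lam * G x <= u (G x) * p x + lam * y.
Proof.
move=> x01 y0; have [_ px0] := pE x x01.
have := right_deriv_linv_supergradient cu ru (c := lam / p x) u_nd _
  (G_gt0 x x01) y0.
rewrite -candE// => /(_ (GE x x01)).
by rewrite mulrAC ler_pdivlMr//; nra.
Qed.

Lemma G_star_optimal (H : R -> R) : admissible s H -> (J_Q u w H <= J_Q u w G)%E.
Proof.
have u_ge0 y : 0 <= y -> 0 <= u y.
  by move=> y0; rewrite -u0; apply: u_nd; rewrite ?in_itv/= ?andbT.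
have mJ K : quantile_function K ->
    measurable_fun `](0 : R), 1[ (fun x => ((u (K x))%:E * right_deriv w (1 - x))%E).
  move=> [_ K0 Knd _]; apply: nondecreasing_in_measurable.
    exact: interval_is_interval.
  move=> x y; rewrite !inE /= !in_itv/= => x01 y01 xy.
  have Kx := K0 x x01; have Ky := K0 y y01.
  have [-> px0] := pE x x01; have [-> py0] := pE y y01.
  rewrite -!EFinM lee_fin; apply: ler_pM; [exact/u_ge0/ltW|exact: ltW|..].
    apply: u_nd; rewrite ?in_itv/= ?andbT; [exact: ltW|exact: ltW|].
    by apply: Knd; rewrite ?in_itv/=; lra.
  by apply: p_nd; lra.
have mK K : quantile_function K -> measurable_fun `](0 : R), 1[ (fun x => (K x)%:E).
  move=> [_ K0 Knd _]; apply: nondecreasing_in_measurable.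
    exact: interval_is_interval.
  move=> x y; rewrite !inE /= !in_itv/= => x01 y01 xy.
  by rewrite lee_fin; apply: Knd; rewrite ?in_itv/=; lra.
have J0 K : quantile_function K -> forall x, `]0, 1[%classic x ->
    (0 <= (u (K x))%:E * right_deriv w (1 - x))%E.
  move=> [_ K0 _ _] x; rewrite /= in_itv/= => x01.
  have [-> px0] := pE x x01.
  by rewrite -EFinM lee_fin mulr_ge0 ?u_ge0// ltW// K0.
have K_ge0 (K : R -> R) : quantile_function K -> forall x, `]0, 1[%classic x ->
    (0 <= (K x)%:E)%E.
  by move=> [_ K0 _ _] x; rewrite /= in_itv/= => x01; rewrite lee_fin ltW// K0.
have lK0 K : quantile_function K -> forall x, `]0, 1[%classic x ->
    (0 <= lam%:E * (K x)%:E)%E.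
  by move=> qK x x01; rewrite mule_ge0// ?lee_fin//; exact: K_ge0.
have mlK K : quantile_function K ->
    measurable_fun `](0 : R), 1[ (fun x => lam%:E * (K x)%:E)%E.
  by move=> qK; apply: measurable_funeM; exact: mK.
move=> [qH Hs]; have [qG Gs] := G_star_admissible.
have sG : (\int[lebesgue_measure]_(x in `]0%R, 1%R[) (G x)%:E = s%:E)%E.
  rewrite -candidate_int; apply: eq_integral => x.
  by rewrite inE /= in_itv/= => x01; rewrite GE.
(* Both values of [J_Q] may be infinite, so nothing is subtracted: the finite [lam * s] is added on
   both sides and cancelled at the end. On the left it is rewritten as [lam] times the integral of
   [G]; on the right it dominates [lam] times that of [H]. *)
have key : (J_Q u w H + (lam * s)%:E <= J_Q u w G + (lam * s)%:E)%E.
  apply: (@le_trans _ _ (J_Q u w G + lam%:E *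
      \int[lebesgue_measure]_(x in `]0%R, 1%R[) (H x)%:E)%E); last first.
    by rewrite EFinM leeD2l// lee_wpmul2l// lee_fin.
  rewrite EFinM -sG -!ge0_integralZl_EFin//; try by [exact: K_ge0|exact: mK].
  rewrite -!ge0_integralD//; try by [exact: J0|exact: mJ|exact: lK0|exact: mlK].
  apply: ge0_le_integral => //.
  - by move=> x x01; rewrite adde_ge0// ?J0// lK0.
  - by apply: emeasurable_funD; [exact: mJ|exact: mlK].
  - by apply: emeasurable_funD; [exact: mJ|exact: mlK].
  move=> x x01; have Hx := K_ge0 _ qH _ x01; move: x01; rewrite /= in_itv/= => x01.
  have [-> _] := pE x x01.
  by rewrite -!EFinM -!EFinD lee_fin; apply: pointwise_optimal; rewrite -?lee_fin.
by move: key; rewrite leeD2rE.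
Qed.

End optimal_quantile.

Theorem theorem5p1 (R : realType) (s : R) (u w : R -> R) (lam : R)
  (s_gt0 : 0 < s)
  (u_ge0 : forall x, 0 <= x -> 0 <= u x)
  (u_nondecreasing : {in `[0, +oo[ &, {homo u : x y / x <= y}})
  (u_ac : forall a b, 0 <= a -> a <= b -> Defs.absolutely_continuous a b u)
  (u0 : u 0 = 0)
  (w_01 : forall x, 0 <= x <= 1 -> 0 <= w x <= 1)
  (w_increasing : {in `[0, 1] &, {homo w : x y / x < y}})
  (w_ac : Defs.absolutely_continuous 0 1 w)
  (w0 : w 0 = 0)
  (w1 : w 1 = 1)
  (u_concave : concave_function `[0, +oo[ u)
  (w_concave : concave_function `[0, 1] w)
  (lam_ge0 : 0 <= lam)
  (candidate_gt0 : forall x, 0 < x < 1 -> (0 < candidate u w lam x)%E)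
  (candidate_int :
    (\int[lebesgue_measure]_(x in `]0%R, 1%R[) candidate u w lam x = s%:E)%E) :
  [/\ (forall x, 0 < x < 1 -> candidate u w lam x \is a fin_num),
      admissible s (G_star u w lam) &
      forall G, admissible s G -> (J_Q u w G <= J_Q u w (G_star u w lam))%E].
Proof.
(* Absolute continuity enters the argument through right continuity; for [u] the compact interval
   [[0, x + 1]] leaves room to the right of [x]. *)
have ru x : 0 <= x -> u t @[t --> x^'+] --> u x.
  move=> x0; have x1 : x < x + 1 by rewrite ltrDl.
  exact: ac_right_continuous (u_ac 0 (x + 1) (lexx 0) (le_trans x0 (ltW x1))) x0 x1.
have rw x : 0 <= x -> x < 1 -> w t @[t --> x^'+] --> w x.
  by move=> x0 x1; exact: ac_right_continuous w_ac x0 x1.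
split.
- by move=> x; apply: candidate_fin_num candidate_int _.
- exact: G_star_admissible candidate_int.
- by move=> G; apply: G_star_optimal candidate_int _.
Qed.
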